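(* Let $M$ be a parallelizable smooth manifold of dimension $m$, $n\ge 1$, $A=C^\infty(M)\otimes M_n(\mathbb{C})$, and let $A^1=\mathrm{Hom}_{Z(A)}(\mathrm{Der}A,A)$ with its basis $\{\theta^i\}_{1\le i\le m+n^2-1}$ and the flip automorphism $\tau$ of $A^1\otimes A^1$ (see context). For a $\tau$-symmetric metric $g$ on $A^1$ put $g^{ij}=g(\theta^i\otimes\theta^j)$, $i,j\in\{1,\dots,m+n^2-1\}$. Then the map $\psi: g\mapsto (g^{ij})$ is a one-to-one correspondence between the $\tau$-symmetric metrics on $A^1$ and the symmetric matrices in $M_{m+n^2-1}(A)$, and (by restriction) a one-to-one correspondence between the middle-linear $\tau$-symmetric metrics on $A^1$ and the symmetric matrices in $M_{m+n^2-1}(Z(A))$.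
   Context: Unadorned $\otimes$ is the tensor product over the ground field $\mathbb{C}$; $C^\infty(M)$ consists of complex-valued functions; $Z(A)=C^\infty(M)\otimes 1$ is the centre of $A$. ''Symmetric matrix'' means $g^{ij}=g^{ji}$. $A^1=\mathrm{Hom}_{Z(A)}(\mathrm{Der}A,A)$ is an $A$-bimodule via $(a\alpha b)(X)=a\,\alpha(X)\,b$. Since $M$ is parallelizable, $\mathrm{Der}A$ is a free $Z(A)$-module with a basis $\{e_i\}_{1\le i\le m+n^2-1}$ ($m$ elements from a global frame of vector fields on $M$, and $n^2-1$ inner derivations from a basis of traceless matrices), and $\{\theta^i\}$ is the dual basis, $\theta^i(e_j)=\delta^i_j 1$. It is a basis of $A^1$ both as a left and as a right $A$-module, and $a\theta^i=\theta^i a$ for all $a\in A$ and all $i$. $\tau:A^1\otimes A^1\to A^1\otimes A^1$ is the bimodule automorphism interchanging arguments, $\tau(\alpha\otimes\beta)(X,Y)=(\alpha\otimes\beta)(Y,X)$ for $X,Y\in\mathrm{Der}A$; it is the bimodule automorphism satisfying $\tau(\theta^i\otimes\theta^j)=\theta^j\otimes\theta^i$ for all $i,j$ (the bimodule structure of $A^1\otimes A^1$ is $a(\zeta\otimes\rho)b=a\zeta\otimes\rho b$). A $\tau$-symmetric metric on an $A$-bimodule $E$ is a linear map $g:E\otimes E\to A$ (no nondegeneracy or reality is required) such that $g(a\zeta,\rho b)=a\,g(\zeta,\rho)\,b$ for all $\zeta,\rho\in E$, $a,b\in A$, and $g\circ\tau=g$. Here $g(\zeta,\rho)=g(\zeta\otimes\rho)$.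 It is middle-linear if it factors through $E\otimes_A E$, i.e. $g(\zeta a,\rho)=g(\zeta,a\rho)$ for all $a\in A$, $\zeta,\rho\in E$. *)

(* Defs.v *)
From HB Require Import structures.
From mathcomp Require Import all_boot all_order all_algebra.
From mathcomp Require Import complex.
From mathcomp Require Import all_classical all_reals all_analysis.

Set Implicit Arguments.
Unset Strict Implicit.
Unset Printing Implicit Defensive.

Import Order.TTheory GRing.Theory Num.Theory.
Import numFieldNormedType.Exports.

Local Open Scope classical_set_scope.
Local Open Scope ring_scope.
Local Open Scope quotient_scope.

Section Tensor.
Variables (K : comPzRingType).
Implicit Types U V W : lmodType K.

(* U ⊗ V is the monoid of formal sums of pairs modulo the congruence         *)
(* generated by commutativity and bilinearity.                                *)
Inductive tensor_rel U V : seq (U * V) -> seq (U * V) -> Prop :=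
| tensor_refl s : tensor_rel s s
| tensor_sym s t : tensor_rel s t -> tensor_rel t s
| tensor_trans s t r : tensor_rel s t -> tensor_rel t r -> tensor_rel s r
| tensor_cat s s' t t' :
    tensor_rel s s' -> tensor_rel t t' -> tensor_rel (s ++ t) (s' ++ t')
| tensor_comm s t : tensor_rel (s ++ t) (t ++ s)
| tensor_0l v : tensor_rel [:: (0, v)] [::]
| tensor_Dl u u' v : tensor_rel [:: (u + u', v)] [:: (u, v); (u', v)]
| tensor_Dr u v v' : tensor_rel [:: (u, v + v')] [:: (u, v); (u, v')]
| tensor_Z k u v : tensor_rel [:: (k *: u, v)] [:: (u, k *: v)].

Definition tensor_relb U V (s t : seq (U * V)) : bool := `[< tensor_rel s t >].

Lemma tensor_relb_refl U V : reflexive (@tensor_relb U V).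
Proof. by move=> s; apply/asboolP; exact: tensor_refl. Qed.

Lemma tensor_relb_sym U V : symmetric (@tensor_relb U V).
Proof. by move=> s t; apply/asboolP/asboolP; exact: tensor_sym. Qed.

Lemma tensor_relb_trans U V : transitive (@tensor_relb U V).
Proof.
by move=> s r t /asboolP rs /asboolP st; apply/asboolP; exact: tensor_trans st.
Qed.

Canonical tensor_equiv U V := EquivRel (@tensor_relb U V)
  (@tensor_relb_refl U V) (@tensor_relb_sym U V) (@tensor_relb_trans U V).

Definition tensor U V : Type := {eq_quot tensor_equiv U V}.
HB.instance Definition _ U V := Choice.on (tensor U V).
HB.instance Definition _ U V := EqQuotient.on (tensor U V).

Definition tensor_of U V (s : seq (U * V)) : tensor U V := \pi_(tensor U V) s.

Lemma tensor_ofP U V (s t : seq (U * V)) :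
  tensor_of s = tensor_of t <-> tensor_rel s t.
Proof.
split=> [/eqmodP/asboolP//|st]; apply/eqmodP; exact/asboolP.
Qed.

Lemma tensor_of_repr U V (t : tensor U V) : tensor_of (repr t) = t.
Proof. exact: reprK. Qed.

Lemma repr_tensor_of U V (s : seq (U * V)) :
  tensor_rel (repr (tensor_of s)) s.
Proof. by apply/tensor_ofP; rewrite tensor_of_repr. Qed.

(* The value on a tensor of the linear map induced by a bilinear map. *)
Definition tensor_lift U V (W : nmodType) (f : U -> V -> W) (t : tensor U V) : W :=
  \sum_(p <- repr t) f p.1 p.2.

Definition bilinear_map U V W (f : U -> V -> W) : Prop :=
  (forall v, linear (f ^~ v)) /\ (forall u, linear (f u)).

Definition opp_rep U V (s : seq (U * V)) := [seq (- p.1, p.2) | p <- s].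
Definition scale_rep U V k (s : seq (U * V)) := [seq (k *: p.1, p.2) | p <- s].

Lemma tensor_rel_scale U V k (s t : seq (U * V)) :
  tensor_rel s t -> tensor_rel (scale_rep k s) (scale_rep k t).
Proof.
elim=> {s t} /=.
- by move=> s; exact: tensor_refl.
- by move=> s t _; exact: tensor_sym.
- by move=> s t r _ + _; exact: tensor_trans.
- by move=> s s' t t' _ + _; rewrite /scale_rep !map_cat; exact: tensor_cat.
- by move=> s t; rewrite /scale_rep !map_cat; exact: tensor_comm.
- by move=> v; rewrite scaler0; exact: tensor_0l.
- by move=> u u' v; rewrite scalerDr; exact: tensor_Dl.
- by move=> u v v'; exact: tensor_Dr.
- move=> k' u v; rewrite scalerA mulrC -scalerA; exact: tensor_Z.
Qed.

Lemma tensor_rel_inv U V (s : seq (U * V)) :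
  tensor_rel (scale_rep (-1) s ++ s) [::].
Proof.
elim: s => [|[u v] s IH] /=; first exact: tensor_refl.
have h1 : tensor_rel ((-1 *: u, v) :: scale_rep (-1) s ++ (u, v) :: s)
    ([:: (-1 *: u, v); (u, v)] ++ (s ++ scale_rep (-1) s)).
  rewrite -[_ :: (_ ++ _)]/([:: (-1 *: u, v)] ++ _ ++ _).
  rewrite -[X in tensor_rel _ X]/([:: (-1 *: u, v)] ++ ((u, v) :: s) ++ _).
  by apply: tensor_cat; [exact: tensor_refl|exact: tensor_comm].
apply: (tensor_trans h1); apply: (@tensor_cat _ _ _ [::] _ [::]).
  apply: (@tensor_trans U V _ [:: (0, v)] _ _ (tensor_0l U v)); apply: tensor_sym.
  by rewrite -[0](addNr u) -scaleN1r; exact: tensor_Dl.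
exact: (tensor_trans (tensor_comm _ _)).
Qed.

Section Module.
Variables U V : lmodType K.
Local Notation T := (tensor U V).

Definition tensor_add (s t : T) : T := tensor_of (repr s ++ repr t).
Definition tensor_scale k (t : T) : T := tensor_of (scale_rep k (repr t)).

Lemma tensor_of_cat (s t : seq (U * V)) :
  tensor_of (s ++ t) = tensor_add (tensor_of s) (tensor_of t).
Proof.
by apply/tensor_ofP; apply: tensor_cat; apply: tensor_sym; exact: repr_tensor_of.
Qed.

Lemma tensor_of_scale k (s : seq (U * V)) :
  tensor_of (scale_rep k s) = tensor_scale k (tensor_of s).
Proof.
by apply/tensor_ofP/tensor_rel_scale; apply: tensor_sym; exact: repr_tensor_of.
Qed.

Lemma tensor_addA : associative tensor_add.
Proof.
move=> x y z; rewrite -(tensor_of_repr x) -(tensor_of_repr y) -(tensor_of_repr z).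
by rewrite -!tensor_of_cat catA.
Qed.

Lemma tensor_addC : commutative tensor_add.
Proof. by move=> x y; apply/tensor_ofP; exact: tensor_comm. Qed.

Lemma tensor_add0 : left_id (tensor_of [::]) tensor_add.
Proof. by move=> x; rewrite -(tensor_of_repr x) -tensor_of_cat. Qed.

Lemma tensor_addN :
  left_inverse (tensor_of [::]) (tensor_scale (-1)) tensor_add.
Proof.
move=> x; rewrite -(tensor_of_repr x) -tensor_of_scale -tensor_of_cat.
exact/tensor_ofP/tensor_rel_inv.
Qed.

HB.instance Definition _ :=
  GRing.isZmodule.Build T tensor_addA tensor_addC tensor_add0 tensor_addN.

Lemma tensor_scaleA a b (x : T) :
  tensor_scale a (tensor_scale b x) = tensor_scale (a * b) x.
Proof.
rewrite -(tensor_of_repr x) -!tensor_of_scale /scale_rep -map_comp.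
by congr tensor_of; apply: eq_map => p /=; rewrite scalerA.
Qed.

Lemma tensor_scale1 : left_id 1 tensor_scale.
Proof.
move=> x; rewrite -{2}(tensor_of_repr x); congr tensor_of.
by rewrite -[RHS]map_id; apply: eq_map => -[u v] /=; rewrite scale1r.
Qed.

Lemma tensor_scaleDr : right_distributive tensor_scale +%R.
Proof.
move=> k x y; rewrite -(tensor_of_repr x) -(tensor_of_repr y).
rewrite -[_ + _]tensor_of_cat -!tensor_of_scale /scale_rep map_cat.
exact: tensor_of_cat.
Qed.

Lemma tensor_scaleDl x : {morph tensor_scale^~ x : a b / a + b}.
Proof.
move=> a b; rewrite -(tensor_of_repr x); elim: (repr x) => [|[u v] s IH].
  by rewrite -!tensor_of_scale /= -[RHS]tensor_of_cat.
rewrite -cat1s tensor_of_cat !tensor_scaleDr IH addrACA; congr (_ + _).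
rewrite -!tensor_of_scale -[RHS]tensor_of_cat; apply/tensor_ofP => /=.
by rewrite scalerDl; exact: tensor_Dl.
Qed.

HB.instance Definition _ := GRing.Zmodule_isLmodule.Build K T
  tensor_scaleA tensor_scale1 tensor_scaleDr tensor_scaleDl.

Definition tens (u : U) (v : V) : T := tensor_of [:: (u, v)].

End Module.

Local Notation "u ⊗ v" := (tens u v) (at level 40).

Lemma tensDl U V (u u' : U) (v : V) : (u + u') ⊗ v = u ⊗ v + u' ⊗ v.
Proof.
by rewrite -[RHS]tensor_of_cat; apply/tensor_ofP; exact: tensor_Dl.
Qed.

Lemma tensDr U V (u : U) (v v' : V) : u ⊗ (v + v') = u ⊗ v + u ⊗ v'.
Proof.
by rewrite -[RHS]tensor_of_cat; apply/tensor_ofP; exact: tensor_Dr.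
Qed.

Lemma tensZl U V k (u : U) (v : V) : (k *: u) ⊗ v = k *: (u ⊗ v).
Proof. by rewrite -[RHS]tensor_of_scale. Qed.

Lemma tensZr U V k (u : U) (v : V) : u ⊗ (k *: v) = k *: (u ⊗ v).
Proof.
by rewrite -tensZl; apply/tensor_ofP; apply: tensor_sym; exact: tensor_Z.
Qed.

Lemma tens_bilinear U V : bilinear_map (@tens U V).
Proof.
by split=> x k a b; rewrite ?(tensDl, tensZl) // tensDr tensZr.
Qed.

Lemma tensor_reprE U V (t : tensor U V) : t = \sum_(p <- repr t) p.1 ⊗ p.2.
Proof.
rewrite -{1}(tensor_of_repr t); elim: (repr t) => [|[u v] s IH].
  by rewrite big_nil.
by rewrite big_cons -IH -[RHS]tensor_of_cat.
Qed.

Lemma tensor_ind U V (P : tensor U V -> Prop) :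
  P 0 -> (forall s t, P s -> P t -> P (s + t)) -> (forall u v, P (u ⊗ v)) ->
  forall t, P t.
Proof.
by move=> P0 PD Pt t; rewrite (tensor_reprE t); elim/big_rec: _ => // p s _; exact: PD.
Qed.

Section Lift.
Variables (U V W : lmodType K) (f : U -> V -> W).
Hypothesis f_bil : bilinear_map f.

Let f0 v : f 0 v = 0.
Proof.
by have := f_bil.1 v (-1) 0 0; rewrite /= scaler0 addr0 scaleN1r addNr.
Qed.

Let fDl u u' v : f (u + u') v = f u v + f u' v.
Proof. by have := f_bil.1 v 1 u u'; rewrite /= !scale1r. Qed.

Let fDr u v v' : f u (v + v') = f u v + f u v'.
Proof. by have := f_bil.2 u 1 v v'; rewrite /= !scale1r. Qed.

Let fZl k u v : f (k *: u) v = k *: f u v.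
Proof. by have := f_bil.1 v k u 0; rewrite /= !addr0 f0 addr0. Qed.

Let fZr k u v : f u (k *: v) = k *: f u v.
Proof.
have g0 : f u 0 = 0.
  by have := f_bil.2 u (-1) 0 0; rewrite /= scaler0 addr0 scaleN1r addNr.
by have := f_bil.2 u k v 0; rewrite /= !addr0 g0 addr0.
Qed.

Lemma tensor_rel_lift s t : tensor_rel s t ->
  \sum_(p <- s) f p.1 p.2 = \sum_(p <- t) f p.1 p.2.
Proof.
elim=> {s t} //=.
- by move=> s t r _ -> _ ->.
- by move=> s s' t t' _ + _; rewrite !big_cat /= => -> ->.
- by move=> s t; rewrite !big_cat /= addrC.
- by move=> v; rewrite big_seq1 big_nil.
- by move=> u u' v; rewrite !big_cons !big_nil !addr0 /= fDl.
- by move=> u v v'; rewrite !big_cons !big_nil !addr0 /= fDr.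
- by move=> k u v; rewrite !big_seq1 /= fZl fZr.
Qed.

Lemma tensor_lift_of s : tensor_lift f (tensor_of s) = \sum_(p <- s) f p.1 p.2.
Proof. exact/tensor_rel_lift/repr_tensor_of. Qed.

Lemma tensor_lift_tens u v : tensor_lift f (u ⊗ v) = f u v.
Proof. by rewrite tensor_lift_of big_seq1. Qed.

Lemma tensor_lift_linear : linear (tensor_lift f).
Proof.
move=> k x y; rewrite -(tensor_of_repr x) -(tensor_of_repr y).
rewrite -[k *: _]tensor_of_scale -[tensor_of _ + _]tensor_of_cat !tensor_lift_of big_cat big_map /=.
by rewrite scaler_sumr; congr (_ + _); apply: eq_bigr => p _; rewrite fZl.
Qed.

End Lift.

Lemma tensor_linear_ext U V W (f g : tensor U V -> W) :
  linear f -> linear g -> (forall u v, f (u ⊗ v) = g (u ⊗ v)) -> f =1 g.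
Proof.
move=> fL gL fg; elim/tensor_ind => //.
- have z h : linear h -> h 0 = 0 :> W.
    by move=> /(_ (-1) 0 0); rewrite scaler0 addr0 scaleN1r addNr.
  by rewrite !z.
- by move=> s t es et; have := fL 1 s t; have := gL 1 s t; rewrite !scale1r es et => -> ->.
Qed.

Definition tensor_map U V U' V' (f : U -> U') (g : V -> V') :
    tensor U V -> tensor U' V' :=
  tensor_lift (fun u v => f u ⊗ g v).

Lemma tensor_map_bilinear U V U' V' (f : U -> U') (g : V -> V') :
  linear f -> linear g -> bilinear_map (fun u v => f u ⊗ g v).
Proof.
move=> fL gL; split=> [v|u] k a b /=; first by rewrite fL tensDl tensZl.
by rewrite gL tensDr tensZr.
Qed.

Lemma tensor_map_tens U V U' V' (f : U -> U') (g : V -> V') u v :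
  linear f -> linear g -> tensor_map f g (u ⊗ v) = f u ⊗ g v.
Proof. by move=> fL gL; apply: tensor_lift_tens; exact: tensor_map_bilinear. Qed.

Lemma tensor_map_linear U V U' V' (f : U -> U') (g : V -> V') :
  linear f -> linear g -> linear (tensor_map f g).
Proof. by move=> fL gL; apply: tensor_lift_linear; exact: tensor_map_bilinear. Qed.

End Tensor.

Notation "u ⊗ v" := (tens u v) (at level 40) : ring_scope.

Section TensorMul.
Variables (K : comPzRingType) (U V : lmodType K).
Variables (mU : U -> U -> U) (mV : V -> V -> V).
Hypotheses (mU_bil : bilinear_map mU) (mV_bil : bilinear_map mV).
Local Notation T := (tensor U V).

(* (a ⊗ b) (a' ⊗ b') = aa' ⊗ bb', extended bilinearly *)
Definition tensor_mul (s t : T) : T :=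
  tensor_lift (fun a b => tensor_map (mU a) (mV b) t) s.

Lemma tensor_mul_bilinear_l (t : T) :
  bilinear_map (fun a b => tensor_map (mU a) (mV b) t).
Proof.
have mapL a b : linear (tensor_map (mU a) (mV b)).
  by apply: tensor_map_linear; [exact: mU_bil.2|exact: mV_bil.2].
have mapE a b u v : tensor_map (mU a) (mV b) (u ⊗ v) = mU a u ⊗ mV b v.
  by apply: tensor_map_tens; [exact: mU_bil.2|exact: mV_bil.2].
have sumL k a b a' b' :
    linear (fun t => k *: tensor_map (mU a) (mV b) t + tensor_map (mU a') (mV b') t).
  move=> c x y; rewrite !mapL !scalerDr addrACA; congr (_ + _ + _).
  by rewrite !scalerA mulrC.
split=> [b k a a'|a k b b'] /=.
- apply: (tensor_linear_ext (mapL _ _) (sumL k a b a' b)) => u v.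
  by rewrite !mapE (mU_bil.1 u) tensDl tensZl.
- apply: (tensor_linear_ext (mapL _ _) (sumL k a b a b')) => u v.
  by rewrite !mapE (mV_bil.1 v) tensDr tensZr.
Qed.

Lemma tensor_mulE u v u' v' :
  tensor_mul (u ⊗ v) (u' ⊗ v') = mU u u' ⊗ mV v v'.
Proof.
rewrite /tensor_mul (tensor_lift_tens (tensor_mul_bilinear_l _)).
by rewrite tensor_map_tens //; [exact: mU_bil.2|exact: mV_bil.2].
Qed.

Lemma tensor_mul_bilinear : bilinear_map tensor_mul.
Proof.
split=> [t|s]; first exact: tensor_lift_linear (tensor_mul_bilinear_l t).
elim/tensor_ind: s => [|s s' IH IH'|u v] k x y.
- have z t : tensor_mul 0 t = 0.
    have := tensor_lift_linear (tensor_mul_bilinear_l t) (-1) 0 0.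
    by rewrite scaler0 addr0 scaleN1r addNr.
  by rewrite !z scaler0 addr0.
- have D t : tensor_mul (s + s') t = tensor_mul s t + tensor_mul s' t.
    have := tensor_lift_linear (tensor_mul_bilinear_l t) 1 s s'.
    by rewrite !scale1r.
  by rewrite !D IH IH' scalerDr addrACA.
- rewrite /tensor_mul !(tensor_lift_tens (tensor_mul_bilinear_l _)).
  by rewrite tensor_map_linear //; [exact: mU_bil.2|exact: mV_bil.2].
Qed.

Lemma tensor_mulDl : left_distributive tensor_mul +%R.
Proof. by move=> s s' t; have := tensor_mul_bilinear.1 t 1 s s'; rewrite /= !scale1r. Qed.

Lemma tensor_mulDr : right_distributive tensor_mul +%R.
Proof. by move=> s t t'; have := tensor_mul_bilinear.2 s 1 t t'; rewrite /= !scale1r. Qed.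

Lemma tensor_mul0r t : tensor_mul 0 t = 0.
Proof. by apply: (addIr (tensor_mul 0 t)); rewrite -tensor_mulDl !add0r. Qed.

Lemma tensor_mulr0 t : tensor_mul t 0 = 0.
Proof. by apply: (addIr (tensor_mul t 0)); rewrite -tensor_mulDr !add0r. Qed.

Lemma tensor_mulA : associative mU -> associative mV -> associative tensor_mul.
Proof.
move=> UA VA; elim/tensor_ind => [|s s' IH IH'|u v] x y.
- by rewrite !tensor_mul0r.
- by rewrite !tensor_mulDl IH IH'.
elim/tensor_ind: x => [|s s' IH IH'|u' v'].
- by rewrite !(tensor_mulr0, tensor_mul0r).
- by rewrite !(tensor_mulDl, tensor_mulDr) IH IH'.
elim/tensor_ind: y => [|s s' IH IH'|u'' v''].
- by rewrite !tensor_mulr0.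
- by rewrite !tensor_mulDr IH IH'.
by rewrite !tensor_mulE UA VA.
Qed.

Lemma tensor_mul1l eU eV : left_id eU mU -> left_id eV mV ->
  left_id (eU ⊗ eV) tensor_mul.
Proof.
move=> U1 V1; elim/tensor_ind => [|s s' IH IH'|u v].
- by rewrite tensor_mulr0.
- by rewrite tensor_mulDr IH IH'.
by rewrite tensor_mulE U1 V1.
Qed.

Lemma tensor_mul1r eU eV : right_id eU mU -> right_id eV mV ->
  right_id (eU ⊗ eV) tensor_mul.
Proof.
move=> U1 V1; elim/tensor_ind => [|s s' IH IH'|u v].
- by rewrite tensor_mul0r.
- by rewrite tensor_mulDl IH IH'.
by rewrite tensor_mulE U1 V1.
Qed.

End TensorMul.

Section SmoothOn.
Variables (R : realType) (m : nat).
Local Notation E := 'rV[R]_m.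
Implicit Types (U : set E) (f g : E -> R).

(* Only meaningful for open U, the only case used below. *)
Fixpoint Ck_on (k : nat) (U : set E) (f : E -> R) : Prop :=
  (forall x, U x -> {for x, continuous f}) /\
  if k is k'.+1 then
    forall i : 'I_m,
      (forall x, U x -> derivable f x (delta_mx 0 i)) /\
      Ck_on k' U ('D_(delta_mx 0 i) f)
  else True.

Definition smooth_on U f := forall k, Ck_on k U f.

Lemma Ck_on_ext k U f g : open U -> (forall x, U x -> f x = g x) ->
  Ck_on k U f -> Ck_on k U g.
Proof.
move=> oU; elim: k f g => [|k IH] f g fg [fc fk].
all: have nfg x : U x -> \forall y \near x, f y = g y
  by move=> Ux; exact: filterS fg (open_nbhs_nbhs (conj oU Ux)).
all: have gc x : U x -> {for x, continuous g} by
  move=> Ux; have := fc x Ux; rewrite /prop_for /continuous_at -fg //;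
  exact: (cvg_trans (@near_eq_cvg _ _ (nbhs x) _ f g (nfg x Ux))).
- by split.
- split=> // i; have [df Df] := fk i; split=> [x Ux|].
    by apply: near_eq_derivable (df x Ux); exact: nfg.
  by apply: IH Df => x Ux; apply: near_eq_derive; exact: nfg.
Qed.

Lemma Ck_onW k U f : Ck_on k.+1 U f -> Ck_on k U f.
Proof.
elim: k f => [|k IH] f [fc fk]; first by split.
by split=> // i; have [df Df] := fk i; split=> //; exact: IH.
Qed.

Lemma smooth_on_cst U (c : R) : smooth_on U (fun=> c).
Proof.
move=> k; elim: k c => [|k IH] c; split=> //; try by move=> x _; exact: cst_continuous.
move=> i; split=> [x _|]; first exact: derivable_cst.
rewrite (_ : 'D_(_) _ = fun=> 0); first exact: IH.
by apply/funext => x; exact: derive_cst.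
Qed.

Lemma Ck_onD k U f g : open U ->
  Ck_on k U f -> Ck_on k U g -> Ck_on k U (f + g).
Proof.
move=> oU; elim: k f g => [|k IH] f g [fc fk] [gc gk]; split=> //; try by
  move=> x Ux; apply: continuousD; [exact: fc|exact: gc].
move=> i; have [df Df] := fk i; have [dg Dg] := gk i; split=> [x Ux|].
  by apply: derivableD; [exact: df|exact: dg].
apply: (@Ck_on_ext _ _ ('D_(delta_mx 0 i) f + 'D_(delta_mx 0 i) g)) => //.
  by move=> x Ux; rewrite deriveD//; [exact: df|exact: dg].
exact: IH.
Qed.

Lemma Ck_onM k U f g : open U ->
  Ck_on k U f -> Ck_on k U g -> Ck_on k U (f * g).
Proof.
move=> oU; elim: k f g => [|k IH] f g fk' gk';
  have [fc fk] := fk'; have [gc gk] := gk'; split=> //; try by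
  move=> x Ux; apply: continuousM; [exact: fc|exact: gc].
move=> i; have [df Df] := fk i; have [dg Dg] := gk i; split=> [x Ux|].
  by apply: derivableM; [exact: df|exact: dg].
apply: (@Ck_on_ext _ _ (f * 'D_(delta_mx 0 i) g + g * 'D_(delta_mx 0 i) f)) => //.
  by move=> x Ux; rewrite deriveM//; [exact: df|exact: dg].
by apply: Ck_onD => //; apply: IH => //; exact: Ck_onW.
Qed.

Lemma smooth_onD U f g : open U -> smooth_on U f -> smooth_on U g ->
  smooth_on U (fun x => f x + g x).
Proof. by move=> oU fs gs k; exact: Ck_onD. Qed.

Lemma smooth_onM U f g : open U -> smooth_on U f -> smooth_on U g ->
  smooth_on U (fun x => f x * g x).
Proof. by move=> oU fs gs k; exact: Ck_onM. Qed.

Lemma smooth_onN U f : open U -> smooth_on U f -> smooth_on U (fun x => - f x).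
Proof.
move=> oU fs; have := smooth_onM oU (@smooth_on_cst U (-1)) fs.
by under eq_fun do rewrite mulN1r.
Qed.

End SmoothOn.

(* chart_map and chart_inv are total functions of which only the restrictions  *)
(* to chart_dom and to its (open) image are relevant.                         *)
Record chart (R : realType) (m : nat) (M : topologicalType) := Chart {
  chart_dom : set M;
  chart_map : M -> 'rV[R]_m;
  chart_inv : 'rV[R]_m -> M;
  chart_dom_open : open chart_dom;
  chart_img_open : open (chart_map @` chart_dom);
  chart_mapK : forall p, chart_dom p -> chart_inv (chart_map p) = p;
  chart_map_cont : forall p, chart_dom p -> {for p, continuous chart_map};
  chart_inv_cont : forall x, (chart_map @` chart_dom) x ->
    {for x, continuous chart_inv}
}.

Record smooth_manifold (R : realType) (m : nat) := SmoothManifold {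
  manifold_space :> topologicalType;
  manifold_hausdorff : hausdorff_space manifold_space;
  manifold_second_countable : @second_countable manifold_space;
  atlas : set (chart R m manifold_space);
  atlas_cover : forall p, exists2 c, atlas c & chart_dom c p;
  atlas_compat : forall c d, atlas c -> atlas d -> forall i : 'I_m,
    smooth_on (chart_map c @` (chart_dom c `&` chart_dom d))
      (fun x => chart_map d (chart_inv c x) 0 i)
}.

Section SmoothFunctions.
Variables (R : realType) (m : nat) (M : smooth_manifold R m).
Local Notation C := R[i].

Definition smooth_fun (f : M -> C) : Prop := forall c, atlas c ->
  smooth_on (chart_map c @` chart_dom c)
    (fun x => complex.Re (f (chart_inv c x))) /\
  smooth_on (chart_map c @` chart_dom c)
    (fun x => complex.Im (f (chart_inv c x))).

Definition smooth_funb : {pred M -> C} := fun f => `[< smooth_fun f >].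

Lemma smooth_fun_cst (k : C) : smooth_fun (fun=> k).
Proof. by move=> c _; split; exact: smooth_on_cst. Qed.

Lemma smooth_funD f g : smooth_fun f -> smooth_fun g ->
  smooth_fun (fun p => f p + g p).
Proof.
move=> fs gs c ac; have [f1 f2] := fs c ac; have [g1 g2] := gs c ac.
have oU := @chart_img_open _ _ _ c.
split; [have := smooth_onD oU f1 g1|have := smooth_onD oU f2 g2];
  by congr smooth_on; apply/funext => x; case: (f _) (g _) => [? ?] [].
Qed.

Lemma smooth_funN f : smooth_fun f -> smooth_fun (fun p => - f p).
Proof.
move=> fs c ac; have [f1 f2] := fs c ac; have oU := @chart_img_open _ _ _ c.
split; [have := smooth_onN oU f1|have := smooth_onN oU f2];
  by congr smooth_on; apply/funext => x; case: (f _).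
Qed.

Lemma smooth_funM f g : smooth_fun f -> smooth_fun g ->
  smooth_fun (fun p => f p * g p).
Proof.
move=> fs gs c ac; have [f1 f2] := fs c ac; have [g1 g2] := gs c ac.
have oU := @chart_img_open _ _ _ c.
split.
- have := smooth_onD oU (smooth_onM oU f1 g1) (smooth_onN oU (smooth_onM oU f2 g2)).
  by congr smooth_on; apply/funext => x; case: (f _) (g _) => [? ?] [].
- have := smooth_onD oU (smooth_onM oU f1 g2) (smooth_onM oU f2 g1).
  by congr smooth_on; apply/funext => x; case: (f _) (g _) => [? ?] [].
Qed.

Lemma smooth_fun_conj f : smooth_fun f -> smooth_fun (fun p => conjc (f p)).
Proof.
move=> fs c ac; have [f1 f2] := fs c ac; have oU := @chart_img_open _ _ _ c.
split; [have := f1|have := smooth_onN oU f2];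
  by congr smooth_on; apply/funext => x; case: (f _).
Qed.

Lemma smooth_funb_subring : subring_closed smooth_funb.
Proof.
split=> [|f g /asboolP fs /asboolP gs|f g /asboolP fs /asboolP gs].
- exact/asboolP/smooth_fun_cst.
- by apply/asboolP; apply: smooth_funD => //; exact: smooth_funN.
- by apply/asboolP; exact: smooth_funM.
Qed.

HB.instance Definition _ :=
  GRing.isSubringClosed.Build (M -> C) smooth_funb smooth_funb_subring.

(* Complex valued. *)
Record Cinf := MkCinf { Cinf_fun :> M -> C; _ : Cinf_fun \in smooth_funb }.
HB.instance Definition _ := [isSub for Cinf_fun].
HB.instance Definition _ := [Choice of Cinf by <:].
HB.instance Definition _ := GRing.SubChoice_isSubComPzRing.Build _ _ Cinf smooth_funb_subring.

Lemma CinfP (f : Cinf) : smooth_fun f.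
Proof. exact/asboolP/(valP f). Qed.

Definition mkCinf f (fs : smooth_fun f) : Cinf := MkCinf (asboolT fs).

Definition Cinf_scale (k : C) (f : Cinf) : Cinf := mkCinf (smooth_fun_cst k) * f.

Lemma Cinf_scaleA a b (f : Cinf) :
  Cinf_scale a (Cinf_scale b f) = Cinf_scale (a * b) f.
Proof. by rewrite /Cinf_scale mulrA; congr (_ * _); exact: val_inj. Qed.

Lemma Cinf_scale1 : left_id 1 Cinf_scale.
Proof. by move=> f; rewrite -[RHS]mul1r; congr (_ * _); exact: val_inj. Qed.

Lemma Cinf_scaleDr : right_distributive Cinf_scale +%R.
Proof. by move=> k f g; exact: mulrDr. Qed.

Lemma Cinf_scaleDl f : {morph Cinf_scale^~ f : a b / a + b}.
Proof. by move=> a b; rewrite -mulrDl; congr (_ * _); exact: val_inj. Qed.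

HB.instance Definition _ := GRing.Zmodule_isLmodule.Build C Cinf
  Cinf_scaleA Cinf_scale1 Cinf_scaleDr Cinf_scaleDl.

Lemma Cinf_scaleE k (f : Cinf) p : (k *: f) p = k * f p.
Proof. by []. Qed.

Lemma Cinf_scale_mulE k (f : Cinf) : k *: f = mkCinf (smooth_fun_cst k) * f.
Proof. by []. Qed.

Lemma Cinf_mul_bilinear : bilinear_map (fun f g : Cinf => f * g).
Proof.
split=> f k a b /=; rewrite !Cinf_scale_mulE; first by rewrite mulrDl mulrA.
by rewrite mulrDr mulrCA.
Qed.

Definition Cinf_conj (f : Cinf) : Cinf := mkCinf (smooth_fun_conj (CinfP f)).

(* Real vector fields, as derivations of C^oo(M), extended C-linearly to       *)
(* complex valued functions; the last condition expresses reality.            *)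
Record vector_field := VectorField {
  vector_field_fun :> Cinf -> Cinf;
  vector_field_linear : linear vector_field_fun;
  vector_field_Leibniz : forall f g,
    vector_field_fun (f * g) = vector_field_fun f * g + f * vector_field_fun g;
  vector_field_real : forall f,
    vector_field_fun (Cinf_conj f) = Cinf_conj (vector_field_fun f)
}.

(* Elements of the real tangent space T_pM, as derivations at p. *)
Definition tangent_vector (p : M) (v : Cinf -> C) : Prop :=
  [/\ scalar v,
      forall f g, v (f * g) = v f * g p + f p * v g
    & forall f, v (Cinf_conj f) = conjc (v f)].

(* The values at each p form a basis of the real vector space T_pM. *)
Definition global_frame (X : 'I_m -> vector_field) : Prop :=
  forall p (v : Cinf -> C), tangent_vector p v ->
    exists! c : {ffun 'I_m -> R},
      forall f, v f = \sum_(i < m) (c i)%:C%C * X i f p.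

End SmoothFunctions.

Section MatrixFunctions.
Variables (R : realType) (m : nat) (M : smooth_manifold R m) (n : nat).
Local Notation C := R[i].

Lemma mulmx_bilinear : bilinear_map (@mulmx C n n n).
Proof.
split=> a k b c; first by rewrite mulmxDl scalemxAl.
by rewrite mulmxDr scalemxAr.
Qed.

Definition algA : Type := tensor (Cinf M) 'M[C]_n.
HB.instance Definition _ := GRing.Lmodule.on algA.

Definition algA_mul : algA -> algA -> algA :=
  tensor_mul (fun f g : Cinf M => f * g) (@mulmx C n n n).

HB.instance Definition _ := GRing.Zmodule_isPzRing.Build algA
  (tensor_mulA (@Cinf_mul_bilinear _ _ M) mulmx_bilinear (@mulrA _) (@mulmxA _ _ _ _ _))
  (tensor_mul1l (@Cinf_mul_bilinear _ _ M) mulmx_bilinear (@mul1r _) (@mul1mx _ _ _))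
  (tensor_mul1r (@Cinf_mul_bilinear _ _ M) mulmx_bilinear (@mulr1 _) (@mulmx1 _ _ _))
  (tensor_mulDl (@Cinf_mul_bilinear _ _ M) mulmx_bilinear)
  (tensor_mulDr (@Cinf_mul_bilinear _ _ M) mulmx_bilinear).

Lemma algA_mulE (f g : Cinf M) (B D : 'M[C]_n) :
  (f ⊗ B : algA) * (g ⊗ D : algA) = (f * g) ⊗ (B *m D).
Proof. exact: tensor_mulE (@Cinf_mul_bilinear _ _ M) mulmx_bilinear _ _ _ _. Qed.

Lemma algA_oneE : 1 = (1 : Cinf M) ⊗ 1%:M :> algA.
Proof. by []. Qed.

Lemma algA_scaleAl k (a b : algA) : k *: (a * b) = (k *: a) * b.
Proof.
have := (tensor_mul_bilinear (@Cinf_mul_bilinear _ _ M) mulmx_bilinear).1 b k a 0.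
rewrite /= addr0 => e; apply: esym; apply: (etrans e).
by rewrite (tensor_mul0r (@Cinf_mul_bilinear _ _ M) mulmx_bilinear) addr0.
Qed.

Lemma algA_scaleAr k (a b : algA) : k *: (a * b) = a * (k *: b).
Proof.
have := (tensor_mul_bilinear (@Cinf_mul_bilinear _ _ M) mulmx_bilinear).2 a k b 0.
rewrite /= addr0 => e; apply: esym; apply: (etrans e).
by rewrite (tensor_mulr0 (@Cinf_mul_bilinear _ _ M) mulmx_bilinear) addr0.
Qed.

Definition in_centre (z : algA) : Prop := forall a, z * a = a * z.
Definition centreb : {pred algA} := fun z => `[< in_centre z >].

Lemma centreb_subring : subring_closed centreb.
Proof.
split=> [|x y /asboolP cx /asboolP cy|x y /asboolP cx /asboolP cy];
  apply/asboolP => a.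
- by rewrite mul1r mulr1.
- by rewrite mulrBl mulrBr cx cy.
- by rewrite -mulrA cy mulrA cx mulrA.
Qed.

HB.instance Definition _ :=
  GRing.isSubringClosed.Build algA centreb centreb_subring.

Record centre := MkCentre { centre_val :> algA; _ : centre_val \in centreb }.
HB.instance Definition _ := [isSub for centre_val].
HB.instance Definition _ := [Choice of centre by <:].
HB.instance Definition _ :=
  GRing.SubChoice_isSubPzRing.Build _ _ centre centreb_subring.

Lemma centreP (z : centre) : in_centre z.
Proof. exact/asboolP/(valP z). Qed.

Lemma centre_mulC : commutative (@GRing.mul centre).
Proof. by move=> x y; apply: val_inj; exact: centreP. Qed.

HB.instance Definition _ :=
  GRing.PzRing_hasCommutativeMul.Build centre centre_mulC.

Lemma algA_matrix_form (a : algA) : exists F : 'I_n -> 'I_n -> Cinf M,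
  a = \sum_i \sum_j F i j ⊗ delta_mx i j.
Proof.
elim/tensor_ind: a => [|s t [F ->] [G ->]|f B].
- exists (fun _ _ => 0); rewrite big1 // => i _; rewrite big1 // => j _.
  by have := (tens_bilinear (Cinf M) 'M[C]_n).1 (delta_mx i j) (-1) 0 0;
    rewrite /= scaler0 addr0 scaleN1r addNr.
- exists (fun i j => F i j + G i j); rewrite -big_split; apply: eq_bigr => i _.
  by rewrite -big_split; apply: eq_bigr => j _; rewrite tensDl.
- exists (fun i j => B i j *: f); rewrite {1}(matrix_sum_delta B).
  have fB : {morph (fun D : 'M[C]_n => f ⊗ D) : x y / x + y} by move=> x y; exact: tensDr.
  have f0 : f ⊗ (0 : 'M[C]_n) = 0.
    by apply: (addIr (f ⊗ 0)); rewrite -tensDr !add0r.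
  rewrite (big_morph _ fB f0); apply: eq_bigr => i _.
  rewrite (big_morph _ fB f0); apply: eq_bigr => j _.
  by rewrite tensZr tensZl.
Qed.

Lemma in_centreE (z : algA) : (0 < n)%N ->
  in_centre z <-> exists f : Cinf M, z = f ⊗ 1%:M.
Proof.
move=> n_gt0; split=> [cz|[f ->] a]; last first.
  elim/tensor_ind: a => [|s t IHs IHt|g B]; first by rewrite mul0r mulr0.
    by rewrite mulrDl mulrDr IHs IHt.
  by rewrite !algA_mulE mulrC mulmx1 mul1mx.
pose o := Ordinal n_gt0; have [F zE] := algA_matrix_form z.
exists (F o o).
pose e i j : algA := (1 : Cinf M) ⊗ delta_mx i j.
have e1 : \sum_k e k o * e o k = 1.
  rewrite algA_oneE mx1_sum_delta.
  have fB : {morph (fun D : 'M[C]_n => (1 : Cinf M) ⊗ D) : x y / x + y}.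
    by move=> x y; exact: tensDr.
  have f0 : (1 : Cinf M) ⊗ (0 : 'M[C]_n) = 0.
    by apply: (addIr ((1 : Cinf M) ⊗ 0)); rewrite -tensDr !add0r.
  rewrite (big_morph _ fB f0); apply: eq_bigr => k _.
  by rewrite algA_mulE mul1r mul_delta_mx.
have eFe k : e k o * z * e o k = F o o ⊗ delta_mx k k.
  have F0 (f : Cinf M) : f ⊗ (0 : 'M[C]_n) = 0.
    by apply: (addIr (f ⊗ 0)); rewrite -tensDr !add0r.
  rewrite zE mulr_sumr mulr_suml (bigD1 o) //= [X in _ + X]big1 ?addr0.
    rewrite mulr_sumr mulr_suml (bigD1 o) //= [X in _ + X]big1 ?addr0.
      by rewrite !algA_mulE mul1r mulr1 !mul_delta_mx.
    move=> j jo; rewrite !algA_mulE mul_delta_mx mul_delta_mx_0 ?F0 //.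
  move=> i io; rewrite mulr_sumr mulr_suml big1 // => j _.
  rewrite !algA_mulE mul_delta_mx_0 ?mul0mx ?F0 //.
  by rewrite eq_sym.
rewrite -[z]mul1r -e1 mulr_suml mx1_sum_delta.
have fB : {morph (fun D : 'M[C]_n => F o o ⊗ D) : x y / x + y}.
  by move=> x y; exact: tensDr.
have f0 : F o o ⊗ (0 : 'M[C]_n) = 0.
  by apply: (addIr (F o o ⊗ 0)); rewrite -tensDr !add0r.
rewrite (big_morph _ fB f0); apply: eq_bigr => k _.
by rewrite -mulrA -cz mulrA eFe.
Qed.

Definition derivation (D : algA -> algA) : Prop :=
  linear D /\ forall a b, D (a * b) = D a * b + a * D b.
Definition derivationb : {pred algA -> algA} := fun D => `[< derivation D >].

Lemma derivationb_zmod : zmod_closed derivationb.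
Proof.
split=> [|D D' /asboolP[DL DM] /asboolP[DL' DM']]; apply/asboolP; split.
- by move=> k a b; rewrite scaler0 addr0.
- by move=> a b; rewrite mul0r mulr0 addr0.
- have E c : (D - D') c = D c - D' c by [].
  by move=> k a b; rewrite !E DL DL' opprD addrACA scalerBr.
- have E c : (D - D') c = D c - D' c by [].
  by move=> a b; rewrite !E DM DM' mulrBl mulrBr opprD addrACA.
Qed.

HB.instance Definition _ :=
  GRing.isZmodClosed.Build (algA -> algA) derivationb derivationb_zmod.

Record Der := MkDer { Der_fun :> algA -> algA; _ : Der_fun \in derivationb }.
HB.instance Definition _ := [isSub for Der_fun].
HB.instance Definition _ := [Choice of Der by <:].
HB.instance Definition _ := [SubChoice_isSubZmodule of Der by <:].

Lemma DerP (D : Der) : derivation D.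
Proof. exact/asboolP/(valP D). Qed.

Definition mkDer D (dD : derivation D) : Der := MkDer (asboolT dD).

Lemma Der_scale_subproof (z : centre) (D : Der) : derivation (fun a => (z : algA) * D a).
Proof.
have [DL DM] := DerP D; split=> [k a b|a b].
  by rewrite DL mulrDr algA_scaleAr.
by rewrite DM mulrDr !mulrA [_ * a]centreP.
Qed.

Definition Der_scale z D : Der := mkDer (Der_scale_subproof z D).

Lemma Der_scaleA z z' D : Der_scale z (Der_scale z' D) = Der_scale (z * z') D.
Proof. by apply: val_inj; apply/funext => a; exact: mulrA. Qed.

Lemma Der_scale1 : left_id 1 Der_scale.
Proof. by move=> D; apply: val_inj; apply/funext => a; exact: mul1r. Qed.

Lemma Der_scaleDr : right_distributive Der_scale +%R.
Proof. by move=> z D D'; apply: val_inj; apply/funext => a; exact: mulrDr. Qed.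

Lemma Der_scaleDl D : {morph Der_scale^~ D : z z' / z + z'}.
Proof. by move=> z z'; apply: val_inj; apply/funext => a; exact: mulrDl. Qed.

HB.instance Definition _ := GRing.Zmodule_isLmodule.Build centre Der
  Der_scaleA Der_scale1 Der_scaleDr Der_scaleDl.

Lemma Der_scaleE (z : centre) (D : Der) a : (z *: D) a = (z : algA) * D a.
Proof. by []. Qed.

(* A^1 = Hom_{Z(A)}(Der A, A) *)
Definition form1 (alpha : Der -> algA) : Prop :=
  forall (z : centre) X Y, alpha (z *: X + Y) = (z : algA) * alpha X + alpha Y.
Definition form1b : {pred Der -> algA} := fun alpha => `[< form1 alpha >].

Lemma form1b_submod : subsemimod_closed form1b.
Proof.
split; first split.
- by apply/asboolP => z X Y; rewrite mulr0 addr0.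
- move=> f g /asboolP fP /asboolP gP; apply/asboolP => z X Y.
  have E c : (f + g) c = f c + g c by [].
  by rewrite !E fP gP mulrDr addrACA.
- move=> k f /asboolP fP; apply/asboolP => z X Y.
  have E c : (k *: f) c = k *: f c by [].
  by rewrite !E fP scalerDr algA_scaleAr.
Qed.

HB.instance Definition _ :=
  GRing.isSubSemiModClosed.Build C (Der -> algA) form1b form1b_submod.

Record A1 := MkA1 { A1_fun :> Der -> algA; _ : A1_fun \in form1b }.
HB.instance Definition _ := [isSub for A1_fun].
HB.instance Definition _ := [Choice of A1 by <:].
HB.instance Definition _ :=
  GRing.SubChoice_isSubLmodule.Build C _ _ A1 form1b_submod.

Lemma A1P (alpha : A1) : form1 alpha.
Proof. exact/asboolP/(valP alpha). Qed.

Definition mkA1 alpha (h : form1 alpha) : A1 := MkA1 (asboolT h).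

Lemma A1_bimod_subproof (a : algA) (alpha : A1) (b : algA) :
  form1 (fun X => a * alpha X * b).
Proof.
by move=> z X Y; rewrite A1P mulrDr mulrDl !mulrA (centreP z a).
Qed.

Definition A1_bimod a alpha b : A1 := mkA1 (A1_bimod_subproof a alpha b).

Definition A11_bimod (a : algA) (t : tensor A1 A1) (b : algA) : tensor A1 A1 :=
  tensor_map (fun zeta => A1_bimod a zeta 1) (fun rho => A1_bimod 1 rho b) t.

Lemma Der_vf_subproof (X : vector_field M) :
  derivation (tensor_map X (@id 'M[C]_n)).
Proof.
have XL := @vector_field_linear _ _ _ X.
have idL : linear (@id 'M[C]_n) by [].
have DL := tensor_map_linear XL idL.
have DE f B : tensor_map X id (f ⊗ B) = X f ⊗ B := tensor_map_tens f B XL idL.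
set D := tensor_map _ _ in DL DE *.
split=> // a b.
have DD (s t : algA) : D (s + t) = D s + D t by have := DL 1 s t; rewrite !scale1r.
have D0 : D (0 : algA) = 0 by apply: (addIr (D 0)); rewrite -DD !add0r.
elim/tensor_ind: a => [|s t IHs IHt|f B].
- by rewrite !mul0r D0 mul0r addr0.
- by rewrite mulrDl !DD IHs IHt !mulrDl addrACA.
elim/tensor_ind: b => [|s t IHs IHt|g B'].
- by rewrite !mulr0 D0 mulr0 addr0.
- by rewrite mulrDr !DD IHs IHt !mulrDr addrACA.
by rewrite algA_mulE !DE vector_field_Leibniz tensDl !algA_mulE.
Qed.

Definition Der_vf (X : vector_field M) : Der := mkDer (Der_vf_subproof X).

Lemma Der_inner_subproof (a : algA) : derivation (fun b => a * b - b * a).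
Proof.
split=> [k b c|b c].
  by rewrite mulrDr mulrDl -algA_scaleAr -algA_scaleAl opprD addrACA scalerBr.
by rewrite mulrBl mulrBr !mulrA addrA subrK.
Qed.

Definition Der_inner (a : algA) : Der := mkDer (Der_inner_subproof a).

Definition traceless : {vspace 'M[C]_n} :=
  lker (linfun (fun B : 'M[C]_n => \tr B : C^o)).

Lemma tracelessP (B : 'M[C]_n) : (B \in traceless) = (\tr B == 0).
Proof.
rewrite memv_ker; congr (_ == _).
have tL : linear (fun B : 'M[C]_n => \tr B : C^o).
  by move=> k B1 B2; rewrite mxtraceD mxtraceZ.
pose h := GRing.isLinear.Build _ _ _ _ _ tL.
pose t : {linear 'M[C]_n -> C^o} := HB.pack (fun B : 'M[C]_n => \tr B : C^o) h.
exact: (lfunE t).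
Qed.

Definition Der_basis (X : 'I_m -> vector_field M)
    (E : (n ^ 2 - 1)%N.-tuple 'M[C]_n) (i : 'I_(m + (n ^ 2 - 1))%N) : Der :=
  match fintype.split i with
  | inl j => Der_vf (X j)
  | inr k => Der_inner ((1 : Cinf M) ⊗ tnth E k)
  end.

Definition dual_basis N (e : 'I_N -> Der) (theta : 'I_N -> A1) : Prop :=
  forall i j, theta i (e j) = (i == j)%:R.

Definition bimodule_automorphism (tau : tensor A1 A1 -> tensor A1 A1) : Prop :=
  [/\ linear tau,
      forall a t b, tau (A11_bimod a t b) = A11_bimod a (tau t) b
    & bijective tau].

(* A1 ⊗ A1 is free as a bimodule on the theta i ⊗ theta j, so this determines *)
(* tau.                                                                       *)
Definition is_flip N (theta : 'I_N -> A1) (tau : tensor A1 A1 -> tensor A1 A1) :=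
  bimodule_automorphism tau /\
  forall i j, tau (theta i ⊗ theta j) = theta j ⊗ theta i.

Definition sym_metric (tau : tensor A1 A1 -> tensor A1 A1)
    (g : tensor A1 A1 -> algA) : Prop :=
  [/\ linear g,
      forall zeta rho a b,
        g (A1_bimod a zeta 1 ⊗ A1_bimod 1 rho b) = a * g (zeta ⊗ rho) * b
    & g \o tau = g].

Definition middle_linear (g : tensor A1 A1 -> algA) : Prop :=
  forall zeta rho a,
    g (A1_bimod 1 zeta a ⊗ rho) = g (zeta ⊗ A1_bimod a rho 1).

Definition metric_matrix N (theta : 'I_N -> A1) (g : tensor A1 A1 -> algA) :
    'M[algA]_N :=
  \matrix_(i, j) g (theta i ⊗ theta j).

End MatrixFunctions.

(* Main.v *)
Require Import Defs.
From HB Require Import structures.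
From mathcomp Require Import all_boot all_order all_algebra.
From mathcomp Require Import complex.
From mathcomp Require Import all_classical all_reals all_analysis.
From mathcomp Require Import ring.

Set Implicit Arguments.
Unset Strict Implicit.
Unset Printing Implicit Defensive.

Import Order.TTheory GRing.Theory Num.Theory.
Import numFieldNormedType.Exports.

Local Open Scope classical_set_scope.
Local Open Scope ring_scope.

(* The point is that every alpha in A^1 is sum_i theta^i(.) alpha(e_i) and     *)
(* that theta^i takes central values.  A derivation D of A preserves the       *)
(* centre and induces there a derivation of C^oo(M), whose value at each point *)
(* is a complex combination of the X_i.  By Cramer's rule d D - sum_i h_i X_i  *)
(* vanishes on the centre, hence is inner, where d = det(X_i f_j) is smooth    *)
(* and can be made nonzero at any prescribed point by the choice of the f_j;   *)
(* so d D = sum_i h_i e_i with smooth h_i.  Applying theta^i gives             *)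
(* d theta^i(D) = h_i, so no division by d is ever needed: the smoothness of   *)
(* the coefficients comes from the existence of the dual basis.  A metric is   *)
(* then g(zeta, rho) = sum_ij zeta(e_i) g^ij rho(e_j), and middle-linearity    *)
(* on the theta^i says that g^ij commutes with A.                              *)

(** A metric is determined by its values on the [theta i ⊗ theta j] because the [theta i] span A^1
    from the left and from the right, with coefficients alpha(e_i) ([A1_expand_l], [A1_expand_r]);
    this gives uniqueness in [metricE]. Conversely [metric_of] builds a metric from any matrix, and
    it is invariant under the flip when the matrix is symmetric ([metric_of_flip]). The spanning
    statements rest on [Der_local], which joins [frame_local] for the directions of M with
    [Der_inner_of_scalar0] for the inner ones; [algA_eq_locally] then removes the factor d. For
    middle-linearity, the commutation of [theta i] with A ([dual_bimodC]) carries an element of A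
    across g^ij. *)

(** Choose the [x i] so that the rank is maximal. No further value of [w] can enlarge the row space,
    so it contains all of them, and a column killed by the matrix is killed by every [w y], hence is
    zero. *)
Lemma linear_sep_unitmx (K : fieldType) (V : lmodType K) m
    (w : {linear V -> 'rV[K]_m}) :
  (forall c : 'cV_m, (forall x, w x *m c = 0) -> c = 0) ->
  exists x : 'I_m -> V, (\matrix_i w (x i)) \in unitmx.
Proof.
move=> w_sep; pose P r := `[< exists x : 'I_m -> V, \rank (\matrix_i w (x i)) = r >].
have exP : exists r, P r.
  by exists (\rank (\matrix_(i < m) w 0)); apply/asboolP; exists (fun=> 0).
have ubP r : P r -> (r <= m)%N by move/asboolP => [x <-]; exact: rank_leq_row.
case: (ex_maxnP exP ubP) => r /asboolP[x xr] r_max; exists x.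
set A := \matrix_i _ in xr *.
have wA y : (w y <= A)%MS.
  apply/negPn/negP => yA.
  (* By linearity the rows of a square matrix generating the enlarged space are again values of [w],
     so the maximality of [r] applies to it. *)
  have Brow i : exists z, row i (<<(A + w y)%MS>>%MS) = w z.
    have : (row i (<<(A + w y)%MS>>%MS) <= A + w y)%MS.
      by rewrite -(genmxE (A + w y)%MS) row_sub.
    case/sub_addsmxP => -[a b] /= ->.
    exists (\sum_j a 0 j *: x j + b 0 0 *: y).
    rewrite linearD linear_sum linearZ /= mulmx_sum_row; congr (_ + _).
      by apply: eq_bigr => j _; rewrite rowK linearZ.
    by rewrite [b]mx11_scalar mul_scalar_mx mxE eqxx mulr1n.
  have [z zE] := choice Brow.
  have : P (\rank (A + w y)%MS).
    apply/asboolP; exists z; rewrite -[RHS]mxrank_gen.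
    by congr (\rank _); apply/row_matrixP => i; rewrite rowK zE.
  move=> /r_max; rewrite -xr leqNgt => /negP; apply.
  by apply: rank_ltmx; rewrite ltmxE addsmxSl addsmx_sub submx_refl.
(* Each column of the cokernel matrix is annihilated by all the [w y], since these lie in the row
   space of [A]. *)
suff coA : cokermx A = 0.
  have := mxrank_coker A; rewrite coA mxrank0 => /esym/eqP.
  by rewrite subn_eq0 -row_free_unit row_leq_rank.
apply/trmx_inj/row_matrixP => j; rewrite -tr_col trmx0 row0.
rewrite (w_sep (col j _)) ?trmx0 // => y.
by rewrite colE mulmxA; have := wA y; rewrite submxE => /eqP ->; rewrite mul0mx.
Qed.

(** * Evaluation at a point and complex conjugation on smooth functions *)

Section Evaluation.
Variables (R : realType) (m : nat) (M : smooth_manifold R m).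
Local Notation C := R[i].

Definition eval_at (p : M) (f : Cinf M) : C := f p.

Fact eval_at_additive p : zmod_morphism (eval_at p). Proof. by []. Qed.
Fact eval_at_multiplicative p : monoid_morphism (eval_at p). Proof. by []. Qed.
Fact eval_at_scalable p : scalable_for *%R (eval_at p). Proof. by []. Qed.
HB.instance Definition _ p :=
  GRing.isZmodMorphism.Build (Cinf M) C (eval_at p) (eval_at_additive p).
HB.instance Definition _ p :=
  GRing.isMonoidMorphism.Build (Cinf M) C (eval_at p) (eval_at_multiplicative p).
HB.instance Definition _ p :=
  GRing.isScalable.Build C (Cinf M) C *%R (eval_at p) (eval_at_scalable p).

Lemma eval_at_inj (f g : Cinf M) : (forall p, eval_at p f = eval_at p g) -> f = g.
Proof. by move=> fg; apply: val_inj; apply/funext. Qed.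

Lemma Cinf_conjK (f : Cinf M) : Cinf_conj (Cinf_conj f) = f.
Proof. by apply: eval_at_inj => p; exact: conjcK. Qed.

Lemma Cinf_conjD (f g : Cinf M) : Cinf_conj (f + g) = Cinf_conj f + Cinf_conj g.
Proof. by apply: eval_at_inj => p; exact: (rmorphD conjc). Qed.

Lemma Cinf_conjM (f g : Cinf M) : Cinf_conj (f * g) = Cinf_conj f * Cinf_conj g.
Proof. by apply: eval_at_inj => p; exact: (rmorphM conjc). Qed.

Lemma Cinf_conjZ k (f : Cinf M) : Cinf_conj (k *: f) = conjc k *: Cinf_conj f.
Proof. by apply: eval_at_inj => p; exact: (rmorphM conjc). Qed.

End Evaluation.

(** * Complex derivations of the smooth functions in terms of a real global frame *)

Section Frame.
Variables (R : realType) (m : nat) (M : smooth_manifold R m).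
Variables (X : 'I_m -> vector_field M) (X_frame : global_frame X).
Local Notation C := R[i].

(** A global frame only speaks of real tangent vectors; adding to k v its conjugate makes it
    real. *)
Lemma Re_tangent_vector (p : M) (v : Cinf M -> C) (k : C) :
    scalar v -> (forall f g, v (f * g) = v f * g p + f p * v g) ->
  tangent_vector p (fun f => k * v f + conjc (k * v (Cinf_conj f))).
Proof.
move=> vL vM; split=> [a f g|f g|f] /=.
- rewrite Cinf_conjD Cinf_conjZ !vL !(rmorphM conjc, rmorphD conjc) /= conjcK; ring.
- rewrite Cinf_conjM !vM !(rmorphM conjc, rmorphD conjc) /= !conjcK; ring.
- by rewrite Cinf_conjK !(rmorphD conjc) /= conjcK addrC.
Qed.

Lemma frame_span (p : M) (v : Cinf M -> C) :
    scalar v -> (forall f g, v (f * g) = v f * g p + f p * v g) ->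
  exists c : 'I_m -> C, forall f, v f = \sum_i c i * X i f p.
Proof.
move=> vL vM.
(* The factors 1/2 and -i/2 produce the real and imaginary parts of [v], so that v = a + i b. *)
have [a [aE _]] := X_frame (Re_tangent_vector 2^-1 vL vM).
have [b [bE _]] := X_frame (Re_tangent_vector (- 'i%C / 2) vL vM).
exists (fun i => (a i)%:C%C + 'i%C * (b i)%:C%C) => f.
under eq_bigr do rewrite mulrDl -mulrA.
rewrite big_split -mulr_sumr /= -aE -bE.
have cM (x y : C) : conjc (x * y) = conjc x * conjc y by exact: rmorphM.
have c2 : conjc 2^-1 = 2^-1 :> C by rewrite conjc_inv conjc_nat.
have ci : conjc (- 'i%C) = 'i%C :> C.
  by apply/eqP; rewrite eq_complex /= !oppr0 opprK !eqxx.
rewrite !cM c2 ci.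
have i2 : 'i%C * 'i%C = -1 :> C by rewrite -expr2 sqr_i.
set x := v f; set y := conjc _.
have -> : 2^-1 * x + 2^-1 * y + 'i%C * (- 'i%C / 2 * x + 'i%C / 2 * y) =
  2^-1 * (x + y) + 2^-1 * ('i%C * 'i%C) * (y - x) by ring.
by rewrite i2; field.
Qed.

(** Uniqueness of the coordinates of the zero vector gives independence over the reals; a complex
    relation splits into two real ones. *)
Lemma frame_free (p : M) (c : 'I_m -> C) :
  (forall f, \sum_i c i * X i f p = 0) -> forall i, c i = 0.
Proof.
move=> c0.
have T0 : tangent_vector p (fun=> 0 : C).
  split=> [k f g|f g|f]; first by rewrite /= mulr0 addr0.
    by rewrite /= mul0r mulr0 addr0.
  exact/esym/conjc0.
have [a [_ a_uniq]] := X_frame T0.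
have real0 (b : 'I_m -> R) : 
    (forall f, \sum_i (b i)%:C%C * X i f p = 0) -> forall i, b i = 0.
  move=> b0 i.
  have ab : a = finfun b.
    apply: a_uniq => f; rewrite -[LHS](b0 f).
    by apply: eq_bigr => j _; rewrite ffunE.
  have a0 : a = [ffun=> 0].
    by apply: a_uniq => f; rewrite big1 // => j _; rewrite ffunE mul0r.
  by have := congr1 (fun h : {ffun 'I_m -> R} => h i) ab; rewrite a0 !ffunE.
(* Conjugate the relation at the conjugate of [f], using that the [X i] are real. Adding and
   subtracting the two relations isolates the real and imaginary parts of [c]. *)
have cc0 f : \sum_i conjc (c i) * X i f p = 0.
  have := c0 (Cinf_conj f) => /(congr1 conjc).
  rewrite (rmorph0 conjc) (rmorph_sum conjc) => e.
  rewrite -[RHS]e; apply: eq_bigr => i _.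
  by rewrite (rmorphM conjc) /= vector_field_real /= conjcK.
move=> i; rewrite [c i]complexE.
rewrite (real0 (fun i => complex.Re (c i)));
  rewrite ?(real0 (fun i => complex.Im (c i))) ?mulr0 ?addr0 //.
- move=> f; under eq_bigr do rewrite ImJ_sub -mulrA mulrAC mulrBl.
  by rewrite -mulr_suml sumrB cc0 c0 subrr mul0r.
- move=> f; under eq_bigr do rewrite ReJ_add mulrAC mulrDl.
  by rewrite -mulr_suml big_split /= cc0 c0 addr0 mul0r.
Qed.

(** Cramer's rule with G = (X_i f_j), where the f_j are chosen so that G(p) is invertible. The
    pointwise coefficients c of [delta] satisfy (delta f_j) = c G, so (delta f_j) adj(G) = det(G) c
    is smooth although nothing is known about c itself. The same d = det(G) serves every [delta]. *)
Lemma frame_local (p : M) : exists d : Cinf M, d p != 0 /\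
  forall delta : Cinf M -> Cinf M, linear delta ->
    (forall f g, delta (f * g) = delta f * g + f * delta g) ->
  exists h : 'I_m -> Cinf M, forall f, d * delta f = \sum_i h i * X i f.
Proof.
pose w f : 'rV[C]_m := \row_i eval_at p (X i f).
have wL : linear w.
  move=> k f g; apply/rowP => i; rewrite !mxE vector_field_linear.
  by rewrite linearP.
pose hw := GRing.isLinear.Build _ _ _ _ _ wL.
pose wl : {linear Cinf M -> 'rV[C]_m} := HB.pack w hw.
have [|f fU] := @linear_sep_unitmx C _ m wl.
  move=> c c0; apply/colP => i; rewrite mxE.
  apply: (@frame_free p (fun i => c i 0)) => g.
  have /matrixP/(_ 0 0) := c0 g; rewrite !mxE => e; rewrite -[RHS]e.
  by apply: eq_bigr => j _; rewrite mxE mulrC.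
pose G : 'M[Cinf M]_m := \matrix_(i, j) X i (f j).
exists (\det G); split.
  move: fU; rewrite unitmxE unitfE -det_tr -[_ p]/(eval_at p _) -det_map_mx.
  by congr (\det _ != 0); apply/matrixP => i j; rewrite !mxE.
move=> delta dL dM; pose u : 'rV_m := \row_j delta (f j).
exists (fun i => (u *m \adj G) 0 i) => g; apply: eval_at_inj => q.
have [|k|c cE] := @frame_span q (fun g => delta g q).
- by move=> k a b; rewrite dL.
- by move=> a; rewrite dM.
have uE : map_mx (eval_at q) u = (\row_i c i) *m map_mx (eval_at q) G.
  apply/rowP => j; rewrite !mxE [LHS]cE; apply: eq_bigr => i _.
  by rewrite !mxE.
transitivity (eval_at q (\det G) * eval_at q (delta g)) => //.
rewrite [RHS]rmorph_sum [eval_at q (delta g)]cE mulr_sumr; apply: eq_bigr => i _.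
transitivity (eval_at q ((u *m \adj G) 0 i) * eval_at q (X i g)) => //.
rewrite mulrA; congr (_ * _).
have -> : eval_at q ((u *m \adj G) 0 i) = (map_mx (eval_at q) (u *m \adj G)) 0 i.
  by rewrite [RHS]mxE.
rewrite map_mxM uE map_mx_adj -mulmxA mul_mx_adj det_map_mx.
by rewrite mul_mx_scalar !mxE.
Qed.

End Frame.

HB.instance Definition _ (K : comPzRingType) (U V : lmodType K) (u : U) :=
  GRing.isLinear.Build K V (tensor U V) *:%R (tens u) ((tens_bilinear U V).2 u).

Lemma tens0l (K : comPzRingType) (U V : lmodType K) (v : V) :
  (0 : U) ⊗ v = 0.
Proof. by apply: (addIr (0 ⊗ v)); rewrite -tensDl !add0r. Qed.

(** * The algebra A as matrix-valued functions, and the structure of its derivations *)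

Section Algebra.
Variables (R : realType) (m : nat) (M : smooth_manifold R m) (n : nat).
Local Notation C := R[i].
Local Notation A := (algA M n).

Lemma algA_ind (P : A -> Prop) :
  P 0 -> (forall a b : A, P a -> P b -> P (a + b)) ->
  (forall f B, P (f ⊗ B)) -> forall a, P a.
Proof. exact: tensor_ind. Qed.

Definition scalar_fun (f : Cinf M) : A := f ⊗ 1%:M.

Lemma scalar_fun_linear : linear scalar_fun.
Proof. by move=> k f g; rewrite /scalar_fun tensDl tensZl. Qed.
HB.instance Definition _ :=
  GRing.isLinear.Build C (Cinf M) A *:%R scalar_fun scalar_fun_linear.

Lemma scalar_funM f g : scalar_fun (f * g) = scalar_fun f * scalar_fun g.
Proof. by rewrite /scalar_fun algA_mulE mul1mx. Qed.

Lemma scalar_fun_mulE f g (B : 'M[C]_n) : scalar_fun f * (g ⊗ B : A) = (f * g) ⊗ B.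
Proof. by rewrite /scalar_fun algA_mulE mul1mx. Qed.

Lemma scalar_fun_central f : in_centre (scalar_fun f).
Proof.
elim/algA_ind => [|s t IHs IHt|g B]; first by rewrite mul0r mulr0.
  by rewrite mulrDl mulrDr IHs IHt.
by rewrite /scalar_fun !algA_mulE mulrC mulmx1 mul1mx.
Qed.

Definition scalar_centre f : centre M n := MkCentre (asboolT (scalar_fun_central f)).

Lemma eval_bilinear p :
  bilinear_map (fun (f : Cinf M) (B : 'M[C]_n) => eval_at p f *: B).
Proof.
split=> [B k f g|f k B D]; first by rewrite linearP scalerDl scalerA.
by rewrite scalerDr !scalerA mulrC.
Qed.

Definition algA_eval (p : M) : A -> 'M[C]_n :=
  tensor_lift (fun (f : Cinf M) (B : 'M[C]_n) => eval_at p f *: B).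

HB.instance Definition _ p := GRing.isLinear.Build C A 'M[C]_n *:%R (algA_eval p)
  (tensor_lift_linear (eval_bilinear p)).

Lemma algA_eval_tens p f B : algA_eval p (f ⊗ B) = eval_at p f *: B.
Proof. exact: tensor_lift_tens (eval_bilinear p) f B. Qed.

Lemma algA_eval_scalarM p f a :
  algA_eval p (scalar_fun f * a) = eval_at p f *: algA_eval p a.
Proof.
elim/algA_ind: a => [|s t IHs IHt|g B]; first by rewrite mulr0 !linear0.
  by rewrite mulrDr !linearD /= IHs IHt.
by rewrite scalar_fun_mulE !algA_eval_tens scalerA.
Qed.

(** If a is the sum of the F_ij ⊗ e_ij, the (i, j) entry of its value at p is F_ij(p). *)
Lemma algA_eval_eq0 (a : A) : (forall p, algA_eval p a = 0) -> a = 0.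
Proof.
have [F ->] := algA_matrix_form a => a0.
rewrite big1 // => i _; rewrite big1 // => j _.
suff -> : F i j = 0 by exact: tens0l.
apply: eval_at_inj => p; have /matrixP/(_ i j) := a0 p.
rewrite linear_sum summxE (bigD1 i) //= linear_sum summxE (bigD1 j) //=.
rewrite algA_eval_tens !mxE !eqxx mulr1 big1 ?addr0 ?big1 ?addr0 //
  => [i' ii'|j' jj'].
  rewrite linear_sum summxE big1 // => j' _.
  by rewrite /= algA_eval_tens !mxE eq_sym (negPf ii') mulr0.
by rewrite /= algA_eval_tens !mxE [j == _]eq_sym (negPf jj') andbF mulr0.
Qed.

(** After evaluation at p the factor d(p) is a nonzero number and cancels; this replaces division by
    a function that may vanish elsewhere. *)
Lemma algA_eq_locally (a b : A) :
  (forall p : M,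
    exists2 d : Cinf M, d p != 0 & scalar_fun d * a = scalar_fun d * b) ->
  a = b.
Proof.
move=> ab; apply/eqP; rewrite -subr_eq0; apply/eqP/algA_eval_eq0 => p.
have [d d0 dab] := ab p.
have : eval_at p d *: algA_eval p (a - b) = 0.
  by rewrite -algA_eval_scalarM mulrBr dab subrr linear0.
by move/eqP; rewrite scaler_eq0 (negPf d0) => /eqP.
Qed.

Lemma Der_addE (D D' : Der M n) a : (D + D') a = D a + D' a.
Proof. by []. Qed.

Lemma Der_oppE (D : Der M n) a : (- D) a = - D a.
Proof. by []. Qed.

Lemma Der_sumE I (r : seq I) (P : pred I) (F : I -> Der M n) a :
  (\sum_(i <- r | P i) F i) a = \sum_(i <- r | P i) F i a.
Proof. by elim/big_rec2: _ => // i x y _ <-. Qed.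

Lemma Der_linear (D : Der M n) : linear D. Proof. exact: (DerP D).1. Qed.
HB.instance Definition _ (D : Der M n) :=
  GRing.isLinear.Build C A A *:%R D (Der_linear D).

Lemma DerM (D : Der M n) a b : D (a * b) = D a * b + a * D b.
Proof. exact: (DerP D).2. Qed.

Lemma Der_vfE (X : vector_field M) f B : Der_vf n X (f ⊗ B) = X f ⊗ B.
Proof. by apply: tensor_map_tens => //; exact: vector_field_linear. Qed.

Hypothesis n_gt0 : (0 < n)%N.
Let o := Ordinal n_gt0.

Definition unit_mx (i j : 'I_n) : A := (1 : Cinf M) ⊗ delta_mx i j.

Lemma unit_mxM i j k l : unit_mx i j * unit_mx k l = (j == k)%:R * unit_mx i l.
Proof.
rewrite /unit_mx algA_mulE mul1r; case: eqP => [->|/eqP jk].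
  by rewrite mul_delta_mx mul1r.
by rewrite mul_delta_mx_0 // mul0r linear0.
Qed.

Lemma unit_mx_sum : \sum_k unit_mx k o * unit_mx o k = 1.
Proof.
rewrite algA_oneE mx1_sum_delta linear_sum; apply: eq_bigr => k _.
by rewrite unit_mxM eqxx mul1r.
Qed.

(* The commutator with [sum_k D(e_ko) e_ok] agrees with D on matrix units. *)
Lemma Der_inner_of_scalar0 (D : Der M n) : (forall f, D (scalar_fun f) = 0) ->
  exists a, forall b, D b = a * b - b * a.
Proof.
move=> D0; have DZ f b : D (scalar_fun f * b) = scalar_fun f * D b.
  by rewrite DerM D0 mul0r add0r.
pose a := \sum_k D (unit_mx k o) * unit_mx o k; exists a => b.
have [F ->] := algA_matrix_form b.
rewrite linear_sum mulr_sumr mulr_suml -sumrB; apply: eq_bigr => i _.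
rewrite linear_sum mulr_sumr mulr_suml -sumrB; apply: eq_bigr => j _.
have -> : F i j ⊗ delta_mx i j = scalar_fun (F i j) * unit_mx i j.
  by rewrite /unit_mx scalar_fun_mulE mulr1.
rewrite /= DZ -mulrA [a * _]mulrA -[a * _](scalar_fun_central (F i j)).
rewrite -!mulrA -mulrBr; congr (_ * _).
have -> : a * unit_mx i j = D (unit_mx i o) * unit_mx o j.
  rewrite mulr_suml (bigD1 i) //= big1 => [|k ki]; last first.
    by rewrite -mulrA unit_mxM (negPf ki) mul0r mulr0.
  by rewrite addr0 -mulrA unit_mxM eqxx mul1r.
(* By Leibniz, e_ij D(e_ko) = D(e_ij e_ko) - D(e_ij) e_ko. After multiplying by e_ok and summing,
   only k = j survives in the first term, and the second sums to D(e_ij). *)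
have -> : unit_mx i j * a = D (unit_mx i o) * unit_mx o j - D (unit_mx i j).
  rewrite -[D (unit_mx i j) in RHS]mulr1 -unit_mx_sum mulr_sumr mulr_sumr.
  transitivity (\sum_k (D (unit_mx i j * unit_mx k o) * unit_mx o k -
     D (unit_mx i j) * (unit_mx k o * unit_mx o k))).
    by apply: eq_bigr => k _; rewrite DerM mulrDl -!mulrA addrC addKr.
  rewrite sumrB; congr (_ - _); rewrite (bigD1 j) //= big1 => [|k kj].
    by rewrite addr0 unit_mxM eqxx mul1r.
  by rewrite unit_mxM eq_sym (negPf kj) mul0r linear0 mul0r.
by rewrite opprB addrC subrK.
Qed.

Variables (E : (n ^ 2 - 1)%N.-tuple 'M[C]_n) (E_basis : basis_of (traceless R n) E).

(** Removing tr(B)/n times the identity makes a matrix traceless. The scalar part g is central, so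
    it disappears from commutators. *)
Lemma algA_traceless_form (a : A) : exists (h : 'I_(n ^ 2 - 1) -> Cinf M) g,
  a = \sum_k scalar_fun (h k) * ((1 : Cinf M) ⊗ tnth E k) + scalar_fun g.
Proof.
elim/algA_ind: a => [|s t [h [g ->]] [h' [g' ->]]|f B].
- exists (fun=> 0), 0; rewrite linear0 addr0 big1 // => k _.
  by rewrite mul0r.
- exists (fun k => h k + h' k), (g + g'); rewrite linearD addrACA -big_split.
  by congr (_ + _); apply: eq_bigr => k _; rewrite linearD mulrDl.
pose c := \tr B / n%:R.
have B0 : B - c%:M \in traceless R n.
  rewrite tracelessP linearB /= mxtrace_scalar -mulr_natr mulfVK ?subrr //.
  by rewrite pnatr_eq0 -lt0n.
exists (fun k => coord E k (B - c%:M) *: f), (c *: f).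
rewrite -[B in LHS](subrK c%:M) {1}(coord_basis E_basis B0) tensDr.
rewrite linear_sum; congr (_ + _).
  apply: eq_bigr => k _; rewrite /= scalar_fun_mulE mulr1 tensZr tensZl.
  by rewrite (tnth_nth 0).
by rewrite -scalemx1 tensZr linearZ.
Qed.

(** Applying D to z a = a z shows that D maps the centre to itself. The linear map [r], which takes
    the (o, o) entry, reads off the function underlying a central element. *)
Lemma Der_scalar_fun (D : Der M n) : exists delta : Cinf M -> Cinf M,
  [/\ linear delta, forall f g, delta (f * g) = delta f * g + f * delta g
    & forall f, D (scalar_fun f) = scalar_fun (delta f)].
Proof.
have r_bil : bilinear_map (fun (f : Cinf M) (B : 'M[C]_n) => B o o *: f).
  split=> [B k f g|f k B B'] /=; first by rewrite scalerDr !scalerA mulrC.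
  by rewrite !mxE scalerDl scalerA.
pose r := tensor_lift (fun (f : Cinf M) (B : 'M[C]_n) => B o o *: f).
have rL : linear r := tensor_lift_linear r_bil.
have rK f : r (scalar_fun f) = f.
  by rewrite [LHS](tensor_lift_tens r_bil) mxE eqxx scale1r.
have DE f : D (scalar_fun f) = scalar_fun (r (D (scalar_fun f))).
  have /(in_centreE _ n_gt0)[g gE] : in_centre (D (scalar_fun f)).
    move=> a; have := congr1 D (scalar_fun_central f a); rewrite !DerM.
    by rewrite [scalar_fun f * _]scalar_fun_central addrC => /addrI.
  by rewrite gE -[g ⊗ _]/(scalar_fun g) rK.
exists (fun f => r (D (scalar_fun f))); split=> // [k f g|f g].
  by rewrite !linearP rL.
by rewrite -[RHS]rK linearD /= !scalar_funM -!DE -DerM.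
Qed.

Variables (X : 'I_m -> vector_field M) (X_frame : global_frame X).

(** Once the vector-field part is subtracted, d D vanishes on scalar functions, hence is the
    commutator with some a; the traceless expansion of a supplies the remaining coefficients. The
    function d depends on p only. *)
Lemma Der_local (p : M) : exists2 d : Cinf M, d p != 0 &
  forall D : Der M n, exists h : 'I_(m + (n ^ 2 - 1)) -> Cinf M,
    scalar_centre d *: D = \sum_i scalar_centre (h i) *: Der_basis X E i.
Proof.
have [d [d0 d_frame]] := frame_local X_frame p; exists d => // D.
have [delta [dL dM DE]] := Der_scalar_fun D.
have [h hE] := d_frame _ dL dM.
pose D' := scalar_centre d *: D - \sum_i scalar_centre (h i) *: Der_vf n (X i).
have [f|a aE] := @Der_inner_of_scalar0 D'.
  rewrite Der_addE Der_oppE Der_sumE Der_scaleE DE -scalar_funM hE linear_sum.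
  rewrite -sumrB big1 // => i _; rewrite Der_scaleE Der_vfE.
  by rewrite /= scalar_funM subrr.
have [h' [g aE']] := algA_traceless_form a.
exists (fun i => match fintype.split i with inl j => h j | inr k => h' k end).
rewrite big_split_ord /= /Der_basis.
under eq_bigr do rewrite (unsplitK (inl _)).
under [X in _ + X]eq_bigr do rewrite (unsplitK (inr _)).
apply/eqP; rewrite addrC -subr_eq; apply/eqP; rewrite -/D'.
apply: val_inj; apply/funext => b; rewrite [LHS]aE [RHS]Der_sumE aE'.
(* The central part [g] of [a] cancels in the commutator. *)
rewrite mulrDl mulrDr -[b * scalar_fun g]scalar_fun_central.
rewrite opprD addrACA subrr addr0.
rewrite mulr_suml mulr_sumr -sumrB; apply: eq_bigr => k _.
by rewrite Der_scaleE /= mulrBr !mulrA (scalar_fun_central _ b).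
Qed.

End Algebra.

Lemma tens_suml (K : comPzRingType) (U V : lmodType K) I (r : seq I) (P : pred I)
    (F : I -> U) (v : V) :
  (\sum_(i <- r | P i) F i) ⊗ v = \sum_(i <- r | P i) F i ⊗ v.
Proof.
by elim/big_rec2: _ => [|i x y _ <-]; [exact: tens0l|exact: tensDl].
Qed.

(** * One-forms, their bimodule structure, and evaluation on linear combinations *)

Section Forms.
Variables (R : realType) (m : nat) (M : smooth_manifold R m) (n : nat).
Local Notation C := R[i].
Local Notation A := (algA M n).
Local Notation A1 := (A1 M n).

Lemma A1_sumE I (r : seq I) (P : pred I) (F : I -> A1) D :
  (\sum_(i <- r | P i) F i) D = \sum_(i <- r | P i) F i D.
Proof. by elim/big_rec2: _ => // i x y _ <-. Qed.

Lemma A1_lin_comb (alpha : A1) N (z : 'I_N -> centre M n) (D : 'I_N -> Der M n) :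
  alpha (\sum_i z i *: D i) = \sum_i (z i : A) * alpha (D i).
Proof.
have a0 : alpha 0 = 0.
  by have := A1P alpha (-1) 0 0; rewrite scaler0 addr0 mulN1r addNr.
by elim/big_rec2: _ => // i x y _ <-; rewrite A1P.
Qed.

Lemma A1Z (alpha : A1) (z : centre M n) D : alpha (z *: D) = (z : A) * alpha D.
Proof.
have := A1_lin_comb alpha (fun _ : 'I_1 => z) (fun=> D).
by rewrite !big_ord1.
Qed.

Lemma A1_bimodE a (alpha : A1) b D : A1_bimod a alpha b D = a * alpha D * b.
Proof. by []. Qed.

Lemma A1_bimod_linear a b : linear (fun alpha : A1 => A1_bimod a alpha b).
Proof.
move=> k x y; apply: val_inj; apply/funext => D.
rewrite -[LHS]/(a * (k *: x D + y D) * b).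
by rewrite mulrDr mulrDl -algA_scaleAr -algA_scaleAl.
Qed.

Lemma A11_bimod_tens a (zeta rho : A1) b :
  A11_bimod a (zeta ⊗ rho) b = A1_bimod a zeta 1 ⊗ A1_bimod 1 rho b.
Proof. by apply: tensor_map_tens; exact: A1_bimod_linear. Qed.

(** * Expansion in the dual basis and the metrics it determines *)

Section DualBasis.
Variables (N : nat) (e : 'I_N -> Der M n) (theta : 'I_N -> A1).
(** Spanning only up to a function nonzero at a prescribed point, which is the form that [Der_local]
    provides. *)
Hypothesis e_span : forall p : M, exists2 d : Cinf M, d p != 0 &
  forall D : Der M n, exists h : 'I_N -> Cinf M,
    scalar_centre n d *: D = \sum_i scalar_centre n (h i) *: e i.
Hypothesis theta_dual : dual_basis e theta.

Lemma dual_coord (d : Cinf M) (h : 'I_N -> Cinf M) (D : Der M n) :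
  scalar_centre n d *: D = \sum_i scalar_centre n (h i) *: e i ->
  forall i, scalar_fun n d * theta i D = scalar_fun n (h i).
Proof.
move=> dD i; have := A1Z (theta i) (scalar_centre n d) D.
rewrite dD A1_lin_comb (bigD1 i) //= big1 ?addr0 => [|j ji].
  by rewrite theta_dual eqxx mulr1 => <-.
by rewrite theta_dual eq_sym (negPf ji) mulr0.
Qed.

(* Away from the zeros of d, [theta i D] is the smooth coefficient (h i) / d. *)
Lemma dual_central i D : in_centre (theta i D).
Proof.
move=> a; apply: algA_eq_locally => p; have [d d0 /(_ D)[h dD]] := e_span p.
exists d => //; rewrite mulrA (dual_coord dD) scalar_fun_central.
by rewrite -(dual_coord dD i) mulrA -(scalar_fun_central d) mulrA.
Qed.

(** Multiplied by d, both sides become the sum of the h_i alpha(e_i); then cancel d locally. *)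
Lemma A1_expand (alpha : A1) D : alpha D = \sum_i theta i D * alpha (e i).
Proof.
apply: algA_eq_locally => p; have [d d0 /(_ D)[h dD]] := e_span p.
exists d => //; rewrite -[LHS](A1Z alpha (scalar_centre n d)) dD A1_lin_comb.
rewrite mulr_sumr.
by apply: eq_bigr => i _; rewrite mulrA (dual_coord dD).
Qed.

Lemma A1_expand_l (alpha : A1) : alpha = \sum_i A1_bimod (alpha (e i)) (theta i) 1.
Proof.
apply: val_inj; apply/funext => D; rewrite [RHS]A1_sumE [LHS]A1_expand.
by apply: eq_bigr => i _; rewrite A1_bimodE mulr1 dual_central.
Qed.

Lemma A1_expand_r (alpha : A1) : alpha = \sum_i A1_bimod 1 (theta i) (alpha (e i)).
Proof.
apply: val_inj; apply/funext => D; rewrite [RHS]A1_sumE [LHS]A1_expand.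
by apply: eq_bigr => i _; rewrite A1_bimodE mul1r.
Qed.

Lemma dual_bimodC i a : A1_bimod 1 (theta i) a = A1_bimod a (theta i) 1.
Proof.
apply: val_inj; apply/funext => D.
rewrite -[LHS]/(1 * theta i D * a) -[RHS]/(a * theta i D * 1).
by rewrite mul1r mulr1 dual_central.
Qed.

(** The tensor product is over the complex numbers, so coefficients can leave only at the outer
    ends: [zeta] is expanded on the left and [rho] on the right. *)
Lemma tens_expand (zeta rho : A1) : zeta ⊗ rho =
  \sum_i \sum_j A11_bimod (zeta (e i)) (theta i ⊗ theta j) (rho (e j)).
Proof.
rewrite [zeta in LHS]A1_expand_l [rho in LHS]A1_expand_r tens_suml.
apply: eq_bigr => i _; rewrite linear_sum; apply: eq_bigr => j _.
by rewrite A11_bimod_tens.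
Qed.

Definition metric_form (G : 'M[A]_N) (zeta rho : A1) : A :=
  \sum_i \sum_j zeta (e i) * G i j * rho (e j).

Lemma metric_form_bilinear G : bilinear_map (metric_form G).
Proof.
split=> [rho k x y|zeta k x y]; rewrite /metric_form scaler_sumr -big_split;
  apply: eq_bigr => i _; rewrite scaler_sumr -big_split; apply: eq_bigr => j _ /=.
- transitivity ((k *: x (e i) + y (e i)) * G i j * rho (e j)) => //.
  by rewrite !mulrDl -!algA_scaleAl.
- transitivity (zeta (e i) * G i j * (k *: x (e j) + y (e j))) => //.
  by rewrite !mulrDr -!algA_scaleAr.
Qed.

Definition metric_of (G : 'M[A]_N) : tensor A1 A1 -> A :=
  tensor_lift (metric_form G).

Lemma metric_of_tens G zeta rho : metric_of G (zeta ⊗ rho) = metric_form G zeta rho.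
Proof. exact: tensor_lift_tens (metric_form_bilinear G) zeta rho. Qed.

Lemma metric_of_bimod G zeta rho a b :
  metric_of G (A1_bimod a zeta 1 ⊗ A1_bimod 1 rho b) =
  a * metric_of G (zeta ⊗ rho) * b.
Proof.
rewrite !metric_of_tens /metric_form mulr_sumr mulr_suml; apply: eq_bigr => i _.
rewrite mulr_sumr mulr_suml; apply: eq_bigr => j _.
by rewrite !A1_bimodE mulr1 mul1r !mulrA.
Qed.

Lemma metric_of_dual G i j : metric_of G (theta i ⊗ theta j) = G i j.
Proof.
rewrite metric_of_tens /metric_form (bigD1 i) //= [X in _ + X]big1 ?addr0 => [|k ki].
  rewrite (bigD1 j) //= [X in _ + X]big1 ?addr0 => [|k kj]; last first.
    by rewrite !theta_dual [j == _]eq_sym (negPf kj) mulr0.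
  by rewrite !theta_dual !eqxx mulr1 mul1r.
by rewrite big1 // => l _; rewrite !theta_dual [i == _]eq_sym (negPf ki) !mul0r.
Qed.

Lemma metricE (g : tensor A1 A1 -> A) : linear g ->
    (forall zeta rho a b,
      g (A1_bimod a zeta 1 ⊗ A1_bimod 1 rho b) = a * g (zeta ⊗ rho) * b) ->
  g = metric_of (metric_matrix theta g).
Proof.
move=> gL gM; apply/funext.
have mL := tensor_lift_linear (metric_form_bilinear (metric_matrix theta g)).
apply: (tensor_linear_ext gL mL) => zeta rho.
pose hg := GRing.isLinear.Build _ _ _ _ _ gL.
pose gl : {linear tensor A1 A1 -> A} := HB.pack g hg.
rewrite [RHS]metric_of_tens tens_expand -[g]/(gl : _ -> _) linear_sum.
apply: eq_bigr => i _; rewrite linear_sum; apply: eq_bigr => j _.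
by rewrite A11_bimod_tens /= gM mxE.
Qed.

Variable (tau : tensor A1 A1 -> tensor A1 A1).
Hypothesis tau_flip : is_flip theta tau.

(** Both sides respect the outer bimodule structure, so it suffices to compare them on the
    [theta i ⊗ theta j], where they give G_ji and G_ij. *)
Lemma metric_of_flip (G : 'M[A]_N) : G^T = G -> metric_of G \o tau = metric_of G.
Proof.
move=> Gsym; have [[tauL tauM _] tauE] := tau_flip.
have mL := tensor_lift_linear (metric_form_bilinear G).
have mtL : linear (metric_of G \o tau) by move=> k x y /=; rewrite tauL [LHS]mL.
apply/funext; apply: (tensor_linear_ext mtL mL) => zeta rho.
pose hm := GRing.isLinear.Build _ _ _ _ _ mL.
pose ml : {linear tensor A1 A1 -> A} := HB.pack (metric_of G) hm.
pose hmt := GRing.isLinear.Build _ _ _ _ _ mtL.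
pose mtl : {linear tensor A1 A1 -> A} := HB.pack (metric_of G \o tau) hmt.
rewrite tens_expand -[_ \o _]/(mtl : _ -> _) -[tensor_lift _]/(ml : _ -> _).
rewrite !linear_sum.
apply: eq_bigr => i _; rewrite !linear_sum; apply: eq_bigr => j _ /=.
rewrite tauM tauE !A11_bimod_tens.
by rewrite !metric_of_bimod !metric_of_dual -[in RHS]Gsym mxE.
Qed.

Lemma sym_metric_of (G : 'M[A]_N) : G^T = G -> sym_metric tau (metric_of G).
Proof.
move=> Gsym; split; last exact: metric_of_flip.
  exact: tensor_lift_linear (metric_form_bilinear G).
exact: metric_of_bimod.
Qed.

Lemma metric_matrix_of (G : 'M[A]_N) : metric_matrix theta (metric_of G) = G.
Proof. by apply/matrixP => i j; rewrite mxE metric_of_dual. Qed.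

Lemma metric_matrix_sym g : sym_metric tau g ->
  (metric_matrix theta g)^T = metric_matrix theta g.
Proof.
move=> [_ _ gtau]; apply/matrixP => i j; rewrite !mxE -[in LHS]gtau /=.
by rewrite tau_flip.2.
Qed.

Lemma metric_matrix_inj g g' : sym_metric tau g -> sym_metric tau g' ->
  metric_matrix theta g = metric_matrix theta g' -> g = g'.
Proof.
by move=> [gL gM _] [gL' gM' _] gg'; rewrite (metricE gL gM) gg' -metricE.
Qed.

Lemma bimod11 (alpha : A1) : A1_bimod 1 alpha 1 = alpha.
Proof.
apply: val_inj; apply/funext => D.
by rewrite -[LHS]/(1 * alpha D * 1) mul1r mulr1.
Qed.

(** Since the [theta i] commute with A, a g^ij = g(theta^i a, theta^j) = g(theta^i, a theta^j) =
    g^ij a. *)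
Lemma middle_linear_central g : sym_metric tau g -> middle_linear g ->
  forall i j, in_centre (metric_matrix theta g i j).
Proof.
move=> [_ gM _] g_mid i j a; rewrite mxE.
have := g_mid (theta i) (theta j) a.
rewrite dual_bimodC -(dual_bimodC j).
have := gM (theta i) (theta j) a 1; rewrite bimod11 mulr1 => ->.
by have := gM (theta i) (theta j) 1 a; rewrite bimod11 mul1r => -> ->.
Qed.

(** The two sides differ only in whether a stands before or after the central entry G_ij. *)
Lemma middle_linear_of (G : 'M[A]_N) : (forall i j, in_centre (G i j)) ->
  middle_linear (metric_of G).
Proof.
move=> Gc zeta rho a; rewrite !metric_of_tens.
apply: eq_bigr => i _; apply: eq_bigr => j _.
by rewrite !A1_bimodE mul1r mulr1 -!mulrA; congr (_ * _); rewrite !mulrA Gc.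
Qed.

End DualBasis.
End Forms.

(** * The two correspondences between metrics and matrices *)

Theorem proposition2p1 (R : realType) (m : nat) (M : smooth_manifold R m)
    (n : nat) (n_gt0 : (0 < n)%N)
    (X : 'I_m -> vector_field M) (X_frame : global_frame X)
    (E : (n ^ 2 - 1)%N.-tuple 'M[R[i]]_n) (E_basis : basis_of (traceless R n) E)
    (theta : 'I_(m + (n ^ 2 - 1))%N -> A1 M n)
    (theta_dual : dual_basis (Der_basis X E) theta)
    (tau : tensor (A1 M n) (A1 M n) -> tensor (A1 M n) (A1 M n))
    (tau_flip : is_flip theta tau) :
  set_bij [set g | sym_metric tau g]
          [set G : 'M[algA M n]_(m + (n ^ 2 - 1)) | G^T = G]
          (metric_matrix theta) /\
  set_bij [set g | sym_metric tau g /\ middle_linear g]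
          [set G : 'M[algA M n]_(m + (n ^ 2 - 1)) |
             G^T = G /\ forall i j, in_centre (G i j)]
          (metric_matrix theta).
Proof.
have e_span := Der_local n_gt0 E_basis X_frame.
split; split.
- by move=> g /(metric_matrix_sym tau_flip).
- by move=> g g' /set_mem gs /set_mem gs';
    exact: (metric_matrix_inj e_span theta_dual gs gs').
- move=> G Gsym; exists (metric_of (Der_basis X E) G).
    exact: (sym_metric_of e_span theta_dual tau_flip).
  exact: metric_matrix_of.
- move=> g [gs g_mid]; split; first exact: (metric_matrix_sym tau_flip gs).
  exact: (middle_linear_central e_span theta_dual gs).
- move=> g g' /set_mem[gs _] /set_mem[gs' _].
  exact: (metric_matrix_inj e_span theta_dual gs gs').
- move=> G [Gsym Gc]; exists (metric_of (Der_basis X E) G).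
    by split; [exact: (sym_metric_of e_span theta_dual tau_flip)
              |exact: middle_linear_of].
  exact: metric_matrix_of.
Qed.
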